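(* For integers $n\ge2$, $$D_n^-(s,t,q)=\begin{cases}q^{n(n-1)}s^{k}t^{k+1}D_n^+(s^{-1},t^{-1},q^{-1})&\text{when } n=2k+1,\\ q^{n(n-1)}s^{k-1}t^{k+1}D_n^+(s^{-1},t^{-1},q^{-1})&\text{when } n=2k.\end{cases}$$ Therefore, $$D_n(s,t,q)=\begin{cases}D_n^+(s,t,q)+q^{n(n-1)}s^{k}t^{k+1}D_n^+(s^{-1},t^{-1},q^{-1})&\text{when } n=2k+1,\\ D_n^+(s,t,q)+q^{n(n-1)}s^{k-1}t^{k+1}D_n^+(s^{-1},t^{-1},q^{-1})&\text{when } n=2k.\end{cases}$$
   Context: $\mathfrak{B}_n$ is the group of permutations $w$ of $\{\pm1,\dots,\pm n\}$ with $w(-i)=-w(i)$, written $w=w_1,\dots,w_n$ with $w_i=w(i)$; $\mathfrak{D}_n\subseteq\mathfrak{B}_n$ is the subgroup of those $w$ with an even number of negative entries among $w_1,\dots,w_n$. For $w\in\mathfrak{D}_n$ set $w_{-1}=-w_1$; an index $i\in\{-1,1,2,\dots,n-1\}$ is a descent if $w_i>w_{|i|+1}$ (so $-1$ is a descent iff $-w_1>w_2$). $\mathrm{odes}_D(w)$ (resp. $\mathrm{edes}_D(w)$) is the number of odd (resp. even) descents; the index $-1$ is odd. $\mathrm{inv}_D(w)=|\{1\le i<j\le n:w_i>w_j\}|+|\{1\le i<j\le n:-w_i>w_j\}|$. $\mathfrak{D}_n^+=\{w\in\mathfrak{D}_n:w_n>0\}$ and $\mathfrak{D}_n^-=\mathfrak{D}_n\setminus\mathfrak{D}_n^+$.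 $D_n(s,t,q)$, $D_n^+(s,t,q)$, $D_n^-(s,t,q)$ denote the sums of $s^{\mathrm{edes}_D(w)}t^{\mathrm{odes}_D(w)}q^{\mathrm{inv}_D(w)}$ over $w\in\mathfrak{D}_n$, $\mathfrak{D}_n^+$, $\mathfrak{D}_n^-$ respectively. *)

(* Defs.v *)
From HB Require Import structures.
From mathcomp Require Import all_boot all_order all_algebra all_fingroup.

Set Implicit Arguments.
Unset Strict Implicit.
Unset Printing Implicit Defensive.

Import Order.TTheory GRing.Theory Num.Theory.
Local Open Scope ring_scope.

(* The set {±1, ..., ±n}: (i, false) stands for i + 1, (i, true) for -(i + 1). *)
Definition signed (n : nat) : finType := ('I_n * bool)%type.

Definition signed_opp (n : nat) (x : signed n) : signed n := (x.1, ~~ x.2).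

Definition signed_val (n : nat) (x : signed n) : int :=
  if x.2 then - (x.1.+1)%:Z else (x.1.+1)%:Z.

Definition Bn (n : nat) : {set {perm signed n}} :=
  [set w : {perm signed n} | [forall x, w (signed_opp x) == signed_opp (w x)]].

(* w_i with the 1-based index i of one-line notation; the value is a dummy 0
   for i > n, and the index 0 is never used. *)
Definition entry (n : nat) (w : {perm signed n}) (i : nat) : int :=
  if insub i.-1 is Some j then signed_val (w (j : 'I_n, false)) else 0.

Definition Dn (n : nat) : {set {perm signed n}} :=
  [set w in Bn n | ~~ odd #|[set i : 'I_n | entry w i.+1 < 0]|].

Definition Dn_plus (n : nat) : {set {perm signed n}} :=
  [set w in Dn n | 0 < entry w n].

Definition Dn_minus (n : nat) : {set {perm signed n}} := Dn n :\: Dn_plus n.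

(* The possible descents -1, 1, 2, ..., n - 1. *)
Definition indicesD (n : nat) : seq int :=
  -1 :: [seq i%:Z | i <- iota 1 n.-1].

(* The left-hand side is w_i, where w_{-1} = - w_1. *)
Definition descentD (n : nat) (w : {perm signed n}) (i : int) : bool :=
  (if i == -1 then - entry w 1 else entry w `|i|%N) > entry w `|i|%N.+1.

Definition odesD (n : nat) (w : {perm signed n}) : nat :=
  count (fun i : int => descentD w i && odd `|i|%N) (indicesD n).

Definition edesD (n : nat) (w : {perm signed n}) : nat :=
  count (fun i : int => descentD w i && ~~ odd `|i|%N) (indicesD n).

Definition invD (n : nat) (w : {perm signed n}) : nat :=
  (#|[set p : 'I_n * 'I_n |
        (p.1 < p.2)%N && (entry w p.1.+1 > entry w p.2.+1)%R]|
   + #|[set p : 'I_n * 'I_n |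
        (p.1 < p.2)%N && (- entry w p.1.+1 > entry w p.2.+1)%R]|)%N.

(* D_n(s,t,q), D_n^+(s,t,q) and D_n^-(s,t,q) at elements s, t, q of an
   arbitrary commutative ring; indeterminates are the special case where the
   ring is that of Laurent polynomials or rational functions in s, t, q. *)
Definition Dpoly (R : comUnitRingType) (n : nat) (s t q : R) : R :=
  \sum_(w in Dn n) s ^+ edesD w * t ^+ odesD w * q ^+ invD w.

Definition Dpoly_plus (R : comUnitRingType) (n : nat) (s t q : R) : R :=
  \sum_(w in Dn_plus n) s ^+ edesD w * t ^+ odesD w * q ^+ invD w.

Definition Dpoly_minus (R : comUnitRingType) (n : nat) (s t q : R) : R :=
  \sum_(w in Dn_minus n) s ^+ edesD w * t ^+ odesD w * q ^+ invD w.

(* Main.v *)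
Require Import Defs.
From HB Require Import structures.
From mathcomp Require Import all_boot all_order all_algebra all_fingroup.
From mathcomp Require Import zify.

Set Implicit Arguments.
Unset Strict Implicit.
Unset Printing Implicit Defensive.

Import Order.TTheory GRing.Theory Num.Theory.
Local Open Scope ring_scope.

(** Reversing the sign of every entry of [w] complements each comparison
    [w_i > w_j] and [-w_i > w_j], hence complements the descent set and the
    inversion set, and it exchanges [w_n > 0] and [w_n < 0].  This settles even
    [n], where it preserves the parity of the number of negative entries.
    When [n] is odd that parity changes, so [w_1] is left alone.  For the pairs
    [(1, j)] the two comparisons [w_1 > w_j] and [-w_1 > w_j] are then
    complemented and exchanged: their total is still complemented
    ([comparisons_flip]), which is enough because [invD] counts both and because
    the descents [-1] and [1] have the same parity.

    The sign change is precomposition with a fixed involution [flip n], so it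
    maps [Dn_plus n] bijectively onto [Dn_minus n] ([flip_Dn_minus]), and on the
    two elements of an orbit the statistics add up to the constants
    [n (n - 1)], [n./2.+1] and [(n.-1)./2]
    ([invD_flip], [odesD_flip], [edesD_flip]). *)

(** * Entries of a signed permutation *)

Lemma signed_val_opp n (x : signed n) : signed_val (signed_opp x) = - signed_val x.
Proof. by case: x => i [] /=; rewrite /signed_val /= ?opprK. Qed.

Lemma signed_val_inj n : injective (@signed_val n).
Proof.
move=> [i [|]] [j [|]]; rewrite /signed_val /= => eq_ij; try lia.
  by congr pair; apply: val_inj => /=; lia.
by congr pair; apply: val_inj => /=; lia.
Qed.

Lemma entry_ord n (w : {perm signed n}) (i : 'I_n) :
  entry w i.+1 = signed_val (w (i, false)).
Proof. by rewrite /entry /= valK. Qed.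

Lemma entry_neq0 n (w : {perm signed n}) (i : 'I_n) : entry w i.+1 != 0.
Proof. by rewrite entry_ord /signed_val; case: ifP => _; lia. Qed.

Lemma Bn_opp n (w : {perm signed n}) x :
  w \in Bn n -> w (signed_opp x) = signed_opp (w x).
Proof. by rewrite inE => /forallP/(_ x)/eqP. Qed.

Lemma entry_neq n (w : {perm signed n}) (i j : 'I_n) :
  w \in Bn n -> i != j ->
  entry w i.+1 != entry w j.+1 /\ entry w i.+1 != - entry w j.+1.
Proof.
move=> wB neq_ij; rewrite !entry_ord -signed_val_opp -Bn_opp //.
by split; apply: contra neq_ij => /eqP/signed_val_inj/perm_inj // [->].
Qed.

(** * The sign-changing involution *)

(** Positions count from 0 here, so position 0 is that of [w_1]. *)
Definition flipped (n i : nat) : bool := ~~ (odd n && (i == 0%N)).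

Definition flip_signed n (x : signed n) : signed n :=
  (x.1, x.2 (+) flipped n x.1).

Lemma flip_signedK n : involutive (@flip_signed n).
Proof. by move=> [i b]; rewrite /flip_signed /= -addbA addbb addbF. Qed.

Definition flip n : {perm signed n} := perm (inv_inj (@flip_signedK n)).

Lemma flipK n (w : {perm signed n}) : (flip n * (flip n * w))%g = w.
Proof. by apply/permP => x; rewrite !permM !permE flip_signedK. Qed.

Lemma flip_Bn n (w : {perm signed n}) : w \in Bn n -> (flip n * w)%g \in Bn n.
Proof.
move=> wB; rewrite inE; apply/forallP => x; rewrite !permM !permE.
by rewrite -Bn_opp // /flip_signed /signed_opp /= addNb.
Qed.

Lemma entry_flip n (w : {perm signed n}) (i : 'I_n) : w \in Bn n ->
  entry (flip n * w)%g i.+1 =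
    if flipped n i then - entry w i.+1 else entry w i.+1.
Proof.
move=> wB; rewrite !entry_ord permM permE /flip_signed /=.
by case: ifP => // _; rewrite -signed_val_opp -Bn_opp.
Qed.

Lemma odd_card_addb (T : finType) (P Q : pred T) :
  odd #|[set x | P x (+) Q x]| = odd #|[set x | P x]| (+) odd #|[set x | Q x]|.
Proof.
have oddE (A : pred T) : odd #|[set x | A x]| = \big[addb/false]_x A x.
  rewrite cardsE -sum1_card big_mkcond (big_morph odd oddD (erefl _)).
  by apply: eq_bigr => x _; rewrite unfold_in; case: (A x).
by rewrite !oddE big_split.
Qed.

(** Leaving [w_1] alone when [n] is odd makes the number of sign changes even. *)
Lemma odd_card_flipped n : ~~ odd #|[set i : 'I_n | flipped n i]|.
Proof.
rewrite cardsE -sum1_card big_mkcond /=.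
case: n => [|n]; first by rewrite big_ord0.
rewrite big_ord_recl (eq_bigr (fun=> 1%N)) => [|i _]; last first.
  by rewrite unfold_in /flipped /= andbF.
by rewrite sum1_card card_ord unfold_in /flipped /= andbT oddD; case: (odd n).
Qed.

Lemma flip_Dn n (w : {perm signed n}) : ((flip n * w)%g \in Dn n) = (w \in Dn n).
Proof.
have DnP v : v \in Dn n -> (flip n * v)%g \in Dn n.
  rewrite !inE => /andP[/forallP vB even_v].
  have {}vB : v \in Bn n by rewrite inE; apply/forallP.
  have := flip_Bn vB; rewrite inE => -> /=.
  have -> : [set i : 'I_n | entry (flip n * v)%g i.+1 < 0] =
            [set i : 'I_n | (entry v i.+1 < 0) (+) flipped n i].
    apply/setP => i; rewrite !inE entry_flip //.
    by have := entry_neq0 v i; case: (flipped n i) => /=; lia.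
  by rewrite odd_card_addb (negPf even_v) (negPf (odd_card_flipped n)).
by apply/idP/idP => /DnP //; rewrite flipK.
Qed.

Lemma Dn_Bn n (w : {perm signed n}) : w \in Dn n -> w \in Bn n.
Proof. by rewrite !inE => /andP[]. Qed.

Lemma flip_Dn_minus n (w : {perm signed n}) : (2 <= n)%N ->
  ((flip n * w)%g \in Dn_minus n) = (w \in Dn_plus n).
Proof.
move=> n_ge2; rewrite in_setD [in X in ~~ X]inE [RHS]inE flip_Dn.
case wD: (w \in Dn n) => //=; rewrite andbT.
have lt_n : (n.-1 < n)%N by lia.
have nE : n = (Ordinal lt_n).+1 by rewrite /=; lia.
rewrite [in X in entry _ X]nE [X in _ = (0 < entry _ X)]nE.
rewrite entry_flip ?Dn_Bn // /flipped.
have := entry_neq0 w (Ordinal lt_n).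
have -> : (Ordinal lt_n == 0 :> nat)%N = false by rewrite /=; lia.
by rewrite andbF /=; lia.
Qed.

(** * Complementation of the statistics *)

(** If [w_1] keeps its sign, the comparison [w_1 > - w_j] after the change is
    the negation of [-w_1 > w_j] before it, and vice versa. *)
Lemma comparisons_flip n (w : {perm signed n}) (i j : 'I_n) :
  w \in Bn n -> (i < j)%N ->
  let v := (flip n * w)%g in
  ((entry v i.+1 > entry v j.+1)%R + (- entry v i.+1 > entry v j.+1)%R
   + ((entry w i.+1 > entry w j.+1)%R + (- entry w i.+1 > entry w j.+1)%R))%N
  = 2%N.
Proof.
move=> wB lt_ij v; rewrite /v !entry_flip //.
have neq_ij : i != j by apply: contraTneq lt_ij => ->; rewrite ltnn.
have [neq neqN] := entry_neq wB neq_ij.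
have -> : flipped n j by rewrite /flipped; lia.
by case: (flipped n i); lia.
Qed.

Lemma card_ltn_pairs n :
  (#|[set p : 'I_n * 'I_n | (p.1 < p.2)%N]| * 2 = n * (n - 1))%N.
Proof.
set A := [set p | _].
have -> : #|A| = (\sum_(j < n) j)%N.
  rewrite cardsE -sum1_card.
  rewrite -(pair_big_dep xpredT (fun i j : 'I_n => (i < j)%N) (fun _ _ => 1%N)) /=.
  rewrite (exchange_big_dep xpredT) //=; apply: eq_bigr => j _.
  by rewrite -[RHS]card_ord -sum1_card [RHS](big_ord_widen n (fun=> 1%N)) // ltnW.
rewrite -(big_mkord xpredT id) bin2_sum muln2 bin2 halfK.
by case: n {A} => //= n; rewrite oddM /= andNb subn0 subn1.
Qed.

Lemma invD_flip n (w : {perm signed n}) : w \in Bn n ->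
  (invD (flip n * w)%g + invD w = n * (n - 1))%N.
Proof.
move=> wB; rewrite -card_ltn_pairs /invD.
have cardE (r : pred ('I_n * 'I_n)) :
    #|[set p : 'I_n * 'I_n | (p.1 < p.2)%N && r p]| =
    (\sum_(p : 'I_n * 'I_n | p.1 < p.2) r p)%N.
  by rewrite cardsE -sum1_card big_mkcondr; apply: eq_bigr => p _; case: (r p).
rewrite !cardE -!big_split /= cardsE -sum1_card big_distrl /=.
by apply: eq_bigr => p lt_p; rewrite comparisons_flip.
Qed.

Lemma count_complement (T : eqType) (a b P : pred T) (s : seq T) :
  {in s, forall x, a x = ~~ b x} ->
  (count (fun x => a x && P x) s + count (fun x => b x && P x) s = count P s)%N.
Proof.
elim: s => //= x s IHs ab; rewrite -IHs => [|y ys]; last first.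
  by apply: ab; rewrite inE ys orbT.
by rewrite ab ?mem_head //; case: (b x); case: (P x) => /=; lia.
Qed.

(** Beyond the descents [-1] and [1], both signs in a comparison change. *)
Lemma descentD_flip n (w : {perm signed n}) (i : nat) :
  w \in Bn n -> (1 < i < n)%N ->
  descentD (flip n * w)%g i = ~~ descentD w i.
Proof.
move=> wB /andP[i_gt1 lt_in]; rewrite /descentD /=.
have lt_i'n : (i.-1 < n)%N by lia.
have neq_ij : Ordinal lt_i'n != Ordinal lt_in by rewrite -val_eqE /=; lia.
have [neq _] := entry_neq wB neq_ij.
have := entry_flip (Ordinal lt_i'n) wB; have := entry_flip (Ordinal lt_in) wB.
have -> : flipped n (Ordinal lt_i'n) by rewrite /flipped /=; lia.
have -> : flipped n (Ordinal lt_in) by rewrite /flipped /=; lia.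
move: neq; rewrite /= prednK; last lia.
by move=> neq -> ->; lia.
Qed.

(** The indices [-1] and [1], both odd, stand apart because the involution may
    exchange them. *)
Lemma count_indicesD n (a : pred int) : (2 <= n)%N ->
  count a (indicesD n) =
    (a (-1)%R + a 1%R + count (fun i : nat => a i%:Z) (iota 2 (n - 2)))%N.
Proof.
case: n => [|[|n]] // _; rewrite /indicesD /= subn2 /= count_map addnA.
by congr (_ + _)%N.
Qed.

Lemma descentD_flip_head n (w : {perm signed n}) :
  (2 <= n)%N -> w \in Bn n ->
  let v := (flip n * w)%g in
  (descentD v (-1) + descentD v 1 + (descentD w (-1) + descentD w 1) = 2)%N.
Proof.
case: n w => [|[|n]] // w _ wB v.
have := @comparisons_flip _ w (Ordinal (ltn0Sn n.+1)) (Ordinal (ltn0Sn n : 1 < n.+2)%N) wB isT.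
by rewrite /descentD /= -/v; lia.
Qed.

Lemma count_odd_iota2 m : count odd (iota 2 m) = m./2.
Proof.
elim: m => // m IHm; rewrite -[X in iota _ X]addn1 iotaD count_cat IHm /=; lia.
Qed.

Lemma count_even_iota2 m : count (fun i => ~~ odd i) (iota 2 m) = uphalf m.
Proof.
elim: m => // m IHm; rewrite -[X in iota _ X]addn1 iotaD count_cat IHm /=; lia.
Qed.

Lemma count_descentD_flip n (w : {perm signed n}) (P : pred nat) :
  w \in Bn n ->
  (count (fun i : nat => descentD (flip n * w)%g i%:Z && P i) (iota 2 (n - 2))
   + count (fun i : nat => descentD w i%:Z && P i) (iota 2 (n - 2))
   = count P (iota 2 (n - 2)))%N.
Proof.
move=> wB; apply: count_complement => i; rewrite mem_iota => lt_i.
by apply: descentD_flip => //; lia.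
Qed.

Lemma odesD_flip n (w : {perm signed n}) : (2 <= n)%N -> w \in Bn n ->
  (odesD (flip n * w)%g + odesD w = n./2.+1)%N.
Proof.
move=> n_ge2 wB; rewrite /odesD !count_indicesD //= !andbT.
have := descentD_flip_head n_ge2 wB.
have := count_descentD_flip odd wB; rewrite count_odd_iota2 /=; lia.
Qed.

Lemma edesD_flip n (w : {perm signed n}) : (2 <= n)%N -> w \in Bn n ->
  (edesD (flip n * w)%g + edesD w = n.-1./2)%N.
Proof.
move=> n_ge2 wB; rewrite /edesD !count_indicesD //= !andbF.
have := count_descentD_flip (fun i => ~~ odd i) wB; rewrite count_even_iota2 /=; lia.
Qed.

(** * The generating functions *)

Lemma expr_complement (R : unitRingType) (x : R) (a b c : nat) :
  x \is a GRing.unit -> (a + b = c)%N -> x ^+ a = x ^+ c * x^-1 ^+ b.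
Proof. by move=> xU <-; rewrite exprD exprVn mulrK ?unitrX. Qed.

Lemma Dpoly_minus_flip n (R : comUnitRingType) (s t q : R) : (2 <= n)%N ->
  s \is a GRing.unit -> t \is a GRing.unit -> q \is a GRing.unit ->
  Dpoly_minus n s t q =
    q ^+ (n * (n - 1)) * s ^+ n.-1./2 * t ^+ n./2.+1
      * Dpoly_plus n s^-1 t^-1 q^-1.
Proof.
move=> n_ge2 sU tU qU; rewrite /Dpoly_minus (reindex_inj (mulgI (flip n))) /=.
rewrite /Dpoly_plus big_distrr /=.
apply: eq_big => [w|w]; first exact: flip_Dn_minus.
rewrite flip_Dn_minus // inE => /andP[/Dn_Bn wB _].
rewrite (expr_complement sU (edesD_flip n_ge2 wB)).
rewrite (expr_complement tU (odesD_flip n_ge2 wB)).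
rewrite (expr_complement qU (invD_flip wB)).
by rewrite [X in X * _ = _]mulrACA [LHS]mulrACA; congr (_ * _); rewrite mulrC mulrA.
Qed.

Lemma Dpoly_split n (R : comUnitRingType) (s t q : R) :
  Dpoly n s t q = Dpoly_plus n s t q + Dpoly_minus n s t q.
Proof.
rewrite /Dpoly (big_setID (Dn_plus n)) /=; congr (_ + _).
by rewrite (setIidPr _) //; apply/subsetP => w; rewrite inE => /andP[].
Qed.

Theorem theorem36 (n : nat) (hn : (2 <= n)%N)
    (R : comUnitRingType) (s t q : R)
    (hs : s \is a GRing.unit) (ht : t \is a GRing.unit)
    (hq : q \is a GRing.unit) :
  (forall k : nat,
     (n = (2 * k + 1)%N ->
        Dpoly_minus n s t q =
          q ^+ (n * (n - 1)) * s ^+ k * t ^+ (k + 1)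
            * Dpoly_plus n s^-1 t^-1 q^-1) /\
     (n = (2 * k)%N ->
        Dpoly_minus n s t q =
          q ^+ (n * (n - 1)) * s ^+ (k - 1) * t ^+ (k + 1)
            * Dpoly_plus n s^-1 t^-1 q^-1)) /\
  (forall k : nat,
     (n = (2 * k + 1)%N ->
        Dpoly n s t q =
          Dpoly_plus n s t q
          + q ^+ (n * (n - 1)) * s ^+ k * t ^+ (k + 1)
            * Dpoly_plus n s^-1 t^-1 q^-1) /\
     (n = (2 * k)%N ->
        Dpoly n s t q =
          Dpoly_plus n s t q
          + q ^+ (n * (n - 1)) * s ^+ (k - 1) * t ^+ (k + 1)
            * Dpoly_plus n s^-1 t^-1 q^-1)).
Proof.
have halves k : (n = 2 * k + 1)%N -> n.-1./2 = k /\ n./2.+1 = (k + 1)%N by lia.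
have halves' k : (n = 2 * k)%N -> n.-1./2 = (k - 1)%N /\ n./2.+1 = (k + 1)%N by lia.
by split=> k; split=> [/halves|/halves'] [<- <-];
  rewrite ?Dpoly_split Dpoly_minus_flip.
Qed.
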